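(* Let $N=\{1,\dots,n\}$ be the set of agents, let $T$ be the common strategy space, containing a prescribed strategy $\tau\in T$, and let $u_i:T^n\to\mathbb{R}$ ($i\in N$) be the payoff functions. Let $F,G\subseteq N$ be given disjoint subsets and $H=N\setminus(F\cup G)$. If (1) $T$ is a convex compact subset of a topological vector space, (2) for any $i\in G$, $u_i$ is continuous, and (3) for any $i\in G$, the map $t_i\mapsto u_i(s_F,(t_i,s_{G\setminus\{i\}}),s_H)$ is concave for any strategy profile $s\in T^n$, then a BARNE exists at $(F,G)$. Moreover, if the game is symmetric, then for every $(f,g)$ there exists a symmetric BARNE at $(f,g)$, that is, there exists $\sigma\in T$ such that $s^*_G=\sigma^g=(\sigma,\dots,\sigma)$ is a BARNE at $(f,g)$.
   Context: For $I\subseteq N$, $s_I\in T^{|I|}$ denotes the sub-profile of the agents in $I$; profiles are written by concatenating sub-profiles of disjoint sets of agents, e.g. $u_i(s_F,s_G,s_H)$. Agents in $F$ are Byzantine (arbitrary strategies), agents in $G$ are rational, and agents in $H$ are honest: they always play $\tau$. Standing convention: all strategy profiles $s\in T^n$ are assumed to satisfy $s_H=(\tau,\dots,\tau)$. The numbers $f=|F|$, $g=|G|$, $h=|H|$ satisfy $f+g+h=n$. BARNE at $(F,G)$: a joint strategy $s^*_G\in T^{g}$ such that for all $i\in G$, $$s_i^*\in\arg\max_{s_i\in T}\ \min_{s_F\in T^{f}}\ u_i(s_F,s_i,s^*_{G\setminus\{i\}},s_H).$$ BARNE at $(f,g)$: $s_G^*$ is a BARNE at $(F,G)$ for all disjoint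 $F,G\subseteq N$ with $|F|=f$ and $|G|=g$. The game is symmetric if $u_i(s_1,\dots,s_n)=u_{\pi(i)}(s_{\pi(1)},\dots,s_{\pi(n)})$ for any permutation $\pi$ of $N$, understood in the usual sense that payoffs are invariant under relabeling of the players. *)

(* Defs.v *)
From HB Require Import structures.
From mathcomp Require Import all_boot all_order all_fingroup all_algebra.
From mathcomp Require Import all_classical all_reals all_analysis.
Set Implicit Arguments.
Unset Strict Implicit.
Unset Printing Implicit Defensive.
Import Order.TTheory GRing.Theory Num.Theory.
Import numFieldNormedType.Exports.
Local Open Scope classical_set_scope.
Local Open Scope ring_scope.

Definition minima (R : realType) (A : set R) : set R := A `&` lbound A.

Definition argmax (X : Type) (R : realType) (D : set X) (f : X -> R) : set X :=
  [set x | D x /\ forall y, D y -> f y <= f x].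

Section Game.
(* [topologicalLmodType R] is a real topological vector space, not assumed
   Hausdorff or locally convex. Agents are the elements of ['I_n]; [u i] is only
   ever constrained or evaluated on profiles with values in [T]. *)
Variables (R : realType) (E : topologicalLmodType R) (n : nat).
Variables (T : set E) (tau : E) (u : 'I_n -> {ptws 'I_n -> E} -> R).

Definition profiles : set {ptws 'I_n -> E} := [set s | forall i, T (s i)].

(* Profiles obeying the convention that the agents outside [F] and [G], i.e. the
   honest ones, play [tau]. *)
Definition admissible (F G : {set 'I_n}) : set {ptws 'I_n -> E} :=
  [set s | profiles s /\ forall i, i \notin F :|: G -> s i = tau].

Definition continuous_payoffs (G : {set 'I_n}) : Prop :=
  forall i, i \in G -> {within profiles, continuous (u i)}.

Definition concave_payoffs (F G : {set 'I_n}) : Prop :=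
  forall i, i \in G -> forall s, admissible F G s ->
    convex_function T (fun t : E => - u i (dfwith s i t)).

(* The profile (s_F, s_G, s_H) with s_H = (tau, ..., tau): sub-profiles are read
   off full families, whose values at the other agents are irrelevant. *)
Definition concat (F G : {set 'I_n}) (sF sG : 'I_n -> E) : {ptws 'I_n -> E} :=
  fun j => if j \in F then sF j else if j \in G then sG j else tau.

Definition payoffs_vs_byzantine (F G : {set 'I_n}) (sG : 'I_n -> E) (i : 'I_n)
    (t : E) : set R :=
  [set u i (concat F G sF (dfwith sG i t)) | sF in profiles].

(* The minimum over s_F is required to be attained: [w t] is that minimum when
   agent [i] plays [t]. *)
Definition BARNE (F G : {set 'I_n}) (sG : 'I_n -> E) : Prop :=
  forall i, i \in G -> exists2 w : E -> R,
    forall t, T t -> minima (payoffs_vs_byzantine F G sG i t) (w t)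
    & argmax T w (sG i).

(* An element of T^g is assigned to the agents of [G] in increasing order. *)
Definition assign (G : {set 'I_n}) (g : nat) (x : g.-tuple E) : 'I_n -> E :=
  fun i => nth 0 x (index i (enum G)).

Definition BARNE_sizes (f g : nat) (x : g.-tuple E) : Prop :=
  forall F G : {set 'I_n}, [disjoint F & G]%B -> #|F| = f -> #|G| = g ->
    BARNE F G (assign G x).

(* Invariance under relabelling: after moving the strategy of each agent [j] to
   agent [p j], agent [p i] gets what agent [i] got. With [s] the relabelled
   profile, the original one is [s \o p]. *)
Definition symmetric_game : Prop :=
  forall (p : 'S_n) (i : 'I_n) (s : {ptws 'I_n -> E}), profiles s ->
    u (p i) s = u i (fun j => s (p j)).

End Game.

(* Main.v *)
(* Let V_i(x) be what the rational agent i gets from the profile x when the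
   Byzantine agents answer with the strategies that are worst for i. As a minimum
   over a compact set, V_i is continuous, and it is concave in the strategy of i;
   a BARNE at (F, G) is a Nash equilibrium of the game with payoffs V_i. It is
   given by Ky Fan's inequality for
     phi(x, y) = sum_(i in G) (V_i(y_i, x_(-i)) - V_i(x)).
   For a symmetric game, fix i in G and take instead
     phi(x, y) = V_i(y_i, (x_i, ..., x_i)) - V_i(x_i, ..., x_i),
   so that some sigma is a best response of i to everybody in G playing sigma;
   relabelling the agents carries this over to all agents and to all (F, G) of
   the given sizes.

   By compactness, Ky Fan's inequality reduces to finitely many y, hence to a
   variational inequality on a simplex. The latter is equivalent to Brouwer's
   theorem; it is derived from Scarf's combinatorial lemma, which is a parity
   count on abstract linear orders and needs no triangulation. *)
From HB Require Import structures.
From mathcomp Require Import all_boot zify.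
Set Implicit Arguments.
Unset Strict Implicit.
Unset Printing Implicit Defensive.

(** * Scarf's combinatorial lemma *)

(** One fibre of [f] on [A] has two elements and the others have one: dropping one element of a
    collision keeps the image, and the cardinalities then agree, so [f] is injective on the rest.
    Used for the colours of a room and for the map [mu] of a door. *)
Lemma imset_merges_one_pair (T U : finType) (f : T -> U) (A : {set T}) :
  #|A| = #|f @: A|.+1 ->
  exists a b, [/\ a != b, a \in A, b \in A &
    forall x, x \in A -> (f @: (A :\ x) == f @: A) = (x \in [set a; b])].
Proof.
move=> cA.
have : ~~ dinjectiveb f (mem A).
  apply/negP => /dinjectiveP fA.
  by move: cA; rewrite card_in_imset// => /n_Sn.
case/dinjectivePn => a aA [b]; rewrite !inE => /andP[nab bA] fab.
have imD x z : z \in A -> z != x -> f x = f z -> f @: (A :\ x) = f @: A.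
  move=> zA zx fxz; apply/eqP; rewrite eqEsubset imsetS ?subD1set//=.
  apply/subsetP => _ /imsetP[y yA ->]; have [->|yx] := eqVneq y x.
    by rewrite fxz imset_f// !inE zx.
  by rewrite imset_f// !inE yx.
have inja : {in A :\ a &, injective f}.
  apply/imset_injP; rewrite (imD a b)// 1?eq_sym//.
  by rewrite (cardsD1 a A) aA add1n in cA; case: cA => ->.
exists a, b; split=> // [|x xA]; first by rewrite eq_sym.
rewrite !inE; have [->|xa] /= := eqVneq x a.
  by rewrite (imD a b) ?eqxx// 1?eq_sym.
have [->|xb] := eqVneq x b; first by rewrite (imD b a) ?eqxx// 1?eq_sym.
apply/negbTE/negP => /eqP fx; have : f x \in f @: A by exact: imset_f.
rewrite -fx => /imsetP[z]; rewrite !inE => /andP[zx zA] fxz.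
have [za|za] := eqVneq z a.
  by move: xb; rewrite (inja x b) ?eqxx// ?inE ?xa ?nab// fxz za.
by move: zx; rewrite (inja x z) ?eqxx// ?inE ?xa ?za.
Qed.

Lemma odd_sum (T : finType) (P : pred T) (F : T -> nat) :
  odd (\sum_(i | P i) F i) = odd #|[set i | P i && odd (F i)]|.
Proof.
rewrite -sum1dep_card big_mkcondr !(big_morph odd oddD (erefl : odd 0 = false)).
by apply: eq_bigr => i _; case: (odd (F i)).
Qed.

(* Rooms are the dominant sets with [#|I|] elements, doors the sets with one
   element less. The slack elements [e i] play the part of the boundary: the only
   relevant door in an odd number of rooms consists of slack elements. *)
Section Scarf.
Variables (I X : finType) (r : I -> X -> nat) (e : I -> X) (c : X -> I).
Hypothesis r_inj : forall i, injective (r i).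
Hypothesis r_slack_min : forall i y, r i (e i) <= r i y.
Hypothesis r_slack_max : forall i j y,
  j != i -> y \notin codom e -> r i y < r i (e j).
Hypothesis c_slack : forall i, c (e i) = i.
Variable v0 : X.
Hypothesis v0_slack : v0 \notin codom e.

Definition dominant (A : {set X}) :=
  [forall y, [exists i, [forall x in A, r i y <= r i x]]].

Lemma dominantP (A : {set X}) :
  reflect (forall y, exists i, forall x, x \in A -> r i y <= r i x)
          (dominant A).
Proof.
apply: (iffP forallP) => domA y.
  by have /existsP[i /forall_inP] := domA y; exists i.
by have [i yA] := domA y; apply/existsP; exists i; exact/forall_inP.
Qed.

Definition room (A : {set X}) := dominant A && (#|A| == #|I|).

(** A room with all colours has one such door, missing its element of colour [i0]. A room with
    exactly the colours other than [i0] has two, from its one colour collision; any other room has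
    none. *)
Lemma odd_doors_of_room i0 (A : {set X}) : room A ->
  odd #|[set x in A | c @: (A :\ x) == [set~ i0]]| = (c @: A == setT).
Proof.
move=> /andP[_ /eqP cardA]; have [cA|cA] := eqVneq (c @: A) setT.
  have cinj : {in A &, injective c} by apply/imset_injP; rewrite cA cardA cardsT.
  have /imsetP[x xA xi0] : i0 \in c @: A by rewrite cA inE.
  suff -> : [set x in A | c @: (A :\ x) == [set~ i0]] = [set x] by rewrite cards1.
  apply/setP => z; rewrite !inE; have [->{z}|zx] := eqVneq z x.
    rewrite xA/=; apply/eqP/setP => i; rewrite !inE.
    have [->|ii0] := eqVneq i i0.
      apply/imsetP => -[z]; rewrite !inE => /andP[zx zA] cz.
      by rewrite (cinj z x) ?eqxx// -?xi0 ?cz in zx.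
    have /imsetP[z zA iz] : i \in c @: A by rewrite cA inE.
    apply/imsetP; exists z; rewrite // !inE zA andbT.
    by apply: contra ii0 => /eqP zx; rewrite iz xi0 zx.
  apply/negbTE/negP => /andP[zA /eqP/setP/(_ i0)].
  by rewrite !inE eqxx xi0 imset_f// !inE eq_sym zx.
have [cA'|cA'] := eqVneq (c @: A) [set~ i0].
  have [|a [b [nab aA bA abP]]] := @imset_merges_one_pair _ _ c A.
    by rewrite cA' cardA cardsC1 prednK//; apply/card_gt0P; exists i0.
  suff -> : [set x in A | c @: (A :\ x) == [set~ i0]] = [set a; b].
    by rewrite cards2 nab.
  apply/setP => z; rewrite inE -cA'; have [/abP->//|zA] := boolP (z \in A).
  by apply/esym/negbTE; apply: contra zA; rewrite !inE => /orP[] /eqP->.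
suff -> : [set x in A | c @: (A :\ x) == [set~ i0]] = set0 by rewrite cards0.
apply/setP => z; rewrite !inE; apply/negbTE/negP => /andP[zA /eqP cz].
have sub : [set~ i0] \subset c @: A by rewrite -cz imsetS// subD1set.
have [i0A|i0A] := boolP (i0 \in c @: A).
  case/eqP: cA; apply/setP => i; rewrite inE; have [->//|ii0] := eqVneq i i0.
  by apply: (subsetP sub); rewrite !inE.
case/eqP: cA'; apply/eqP; rewrite eqEsubset sub andbT.
by apply/subsetP => i iA; rewrite !inE; apply: contraNneq i0A => <-.
Qed.

(** The completing element must be [m], the [r i0]-largest one outside the door. Dominance at [m]
    cannot come from an order [i != i0], whose minimum [e i] is in the door while [m] is not
    slack. *)
Lemma outer_door_room i0 :
  #|[set y | (y \notin e @: [set~ i0]) && room (y |: e @: [set~ i0])]| = 1.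
Proof.
set B := e @: [set~ i0].
have e_inj : injective e := can_inj c_slack.
have v0B : v0 \notin B.
  by apply: contra v0_slack => /imsetP[i _ ->]; exact: codom_f.
have [m mB mmax] : exists2 m, m \notin B & forall y, y \notin B -> r i0 y <= r i0 m.
  by have [m mB mmax] := @arg_maxnP _ v0 (fun y => y \notin B) (r i0) v0B; exists m.
have mN : m \notin codom e.
  apply/codomP => -[k mk]; have kE : k = i0.
    by apply/eqP; apply: contraNT mB => kE; rewrite mk imset_f// !inE.
  have := mmax _ v0B; rewrite mk kE => le_v0.
  case/negP: v0_slack; suff -> : v0 = e i0 by exact: codom_f.
  by apply: (@r_inj i0); apply/eqP; rewrite eqn_leq r_slack_min le_v0.
suff -> : [set y | (y \notin B) && room (y |: B)] = [set m] by rewrite cards1.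
apply/setP => y; rewrite !inE; apply/andP/eqP => [[yB /andP[/dominantP dom _]]|->].
  have [i im] := dom m; have ii0 : i = i0.
    apply/eqP; apply: contraNT mN => ii0.
    have /im : e i \in y |: B by rewrite !inE imset_f ?orbT// !inE.
    move=> le_m; suff -> : m = e i by exact: codom_f.
    by apply: (@r_inj i); apply/eqP; rewrite eqn_leq le_m r_slack_min.
  apply: (@r_inj i0); apply/eqP; rewrite eqn_leq mmax//=.
  by rewrite -ii0; apply: im; rewrite !inE eqxx.
split=> //; rewrite /room cardsU1 mB card_imset// cardsC1 add1n prednK ?eqxx ?andbT.
  apply/dominantP => z; have [/imsetP[j _ ->]|zB] := boolP (z \in B).
    by exists j => x _; exact: r_slack_min.
  exists i0 => x; rewrite !inE => /orP[/eqP->|/imsetP[j]]; first exact: mmax.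
  rewrite !inE => ji0 ->; have [/codomP[k zk]|zN] := boolP (z \in codom e).
    suff -> : z = e i0 by exact: r_slack_min.
    rewrite zk; congr e; apply/eqP; apply: contraNT zB => ki0.
    by rewrite zk imset_f// !inE.
  exact/ltnW/r_slack_max.
by apply/card_gt0P; exists i0.
Qed.

(* [mu k], the least element of [B] for [r k], maps [I] onto [B] and merges only
   one pair [i], [j]; the rooms containing [B] are [B] with the element [top i]
   or [top j] added. *)
Lemma inner_door_rooms (B : {set X}) b0 : b0 \in B -> b0 \notin codom e ->
  #|I| = #|B|.+1 -> ~~ odd #|[set y | (y \notin B) && room (y |: B)]|.
Proof.
move=> b0B b0N cardB.
set Y := [set y | _]; have [->|[y0]] := set_0Vmem Y; first by rewrite cards0.
rewrite inE => /andP[y0B /andP[/dominantP dom0 _]].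
have dom z : exists i, forall x, x \in B -> r i z <= r i x.
  by have [i iz] := dom0 z; exists i => x xB; apply: iz; rewrite !inE xB orbT.
have [mu muB muP] : exists2 mu : I -> X, (forall k, mu k \in B) &
    forall k x, x \in B -> r k (mu k) <= r k x.
  exists (fun k => [arg min_(x < b0 in B) r k x]) => [k|k x];
    by case: arg_minnP => // m mB; apply.
have muE k y : y \in B -> (forall x, x \in B -> r k y <= r k x) -> y = mu k.
  by move=> yB ym; apply: (@r_inj k); apply/eqP; rewrite eqn_leq ym// muP.
have muT : mu @: setT = B.
  apply/eqP; rewrite eqEsubset; apply/andP; split; apply/subsetP => x.
    by move=> /imsetP[k _ ->].
  by move=> xB; have [k /(muE _ _ xB)->] := dom x; rewrite imset_f.
have [|i [j [nij _ _ ijP]]] := @imset_merges_one_pair _ _ mu setT.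
  by rewrite muT cardsT.
(* Adding an element of [M k] to [B] leaves the minimum of every order other than [k] in place. *)
pose M k := [pred x | [forall (l | l != k), r l (mu l) < r l x]].
have MP k x : reflect (forall l, l != k -> r l (mu l) < r l x) (M k x).
  exact: (iffP forall_inP).
have eM k : M k (e k).
  apply/MP => l lk; apply: leq_ltn_trans (muP l _ b0B) _.
  by apply: r_slack_max => //; rewrite eq_sym.
pose top k := [arg max_(x > e k | M k x) r k x].
have topM k : M k (top k) by rewrite /top; case: arg_maxnP.
have top_max k x : M k x -> r k x <= r k (top k).
  by rewrite /top; case: arg_maxnP => // m _; apply.
have domM k x : M k x -> forall b, b \in B -> r k x <= r k b.
  move=> /MP xM; have [l lx] := dom x; suff <- : l = k by [].
  by apply/eqP; apply/negPn/negP => /xM; rewrite ltnNge lx.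
(* Dropping such a [k] keeps the image of [mu], so each element of [B] is some [mu l] with [l != k],
   which [M k] excludes. *)
have topB k : k \in [set i; j] -> top k \notin B.
  rewrite -ijP ?inE// muT => /eqP kB; apply/negP => tB.
  have : top k \in mu @: (setT :\ k) by rewrite kB.
  move=> /imsetP[l]; rewrite !inE andbT => lk tl.
  by have /MP/(_ l lk) := topM k; rewrite tl ltnn.
have top_room k : k \in [set i; j] -> room (top k |: B).
  move=> kij; rewrite /room cardsU1 topB// cardB add1n eqxx andbT.
  apply/dominantP => z; have [zM|] := boolP (M k z).
    exists k => x; rewrite !inE => /orP[/eqP->|]; [exact: top_max|exact: domM].
  case/forall_inPn => l lk; rewrite -leqNgt => zl; exists l => x.
  rewrite !inE => /orP[/eqP->|xB]; last exact: leq_trans zl (muP _ _ xB).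
  by apply: leq_trans zl (ltnW _); exact/MP.
have topij : top i != top j.
  apply: contraTneq (domM j _ (topM j) _ (muB j)) => <-; rewrite -ltnNge.
  by have /MP := topM i; apply; rewrite eq_sym.
suff -> : Y = [set top i; top j] by rewrite cards2 topij.
apply/setP => y; rewrite in_set2 inE.
apply/andP/orP => [[yB /andP[/dominantP domy _]]|]; last first.
  by case=> /eqP->; rewrite topB ?top_room// !inE eqxx ?orbT.
have [k ky] := domy y.
(* As [y] is outside [B], dominance at [b] comes from an order [l] whose minimum [mu l = b] lies
   strictly below [y]. *)
have lowP b : b \in B -> exists2 l, b = mu l &
    forall k', r k' y <= r k' (mu k') -> l != k'.
  move=> bB; have [l lb] := domy b.
  have bE : b = mu l by apply: muE => // x xB; apply: lb; rewrite !inE xB orbT.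
  have lby : r l b <= r l y by apply: lb; rewrite !inE eqxx.
  exists l => // k' yk'; apply: contraNneq yB => lk'; rewrite -lk' -bE in yk'.
  suff -> : y = b by [].
  by apply: (@r_inj l); apply/eqP; rewrite eqn_leq lby yk'.
have ymu : r k y <= r k (mu k) by apply: ky; rewrite !inE muB orbT.
have kij : k \in [set i; j].
  rewrite -ijP ?inE// muT eqEsubset; apply/andP; split.
    by rewrite -muT imsetS// subsetT.
  apply/subsetP => b /lowP[l -> /(_ k ymu) lk].
  by rewrite imset_f// !inE lk.
have yM : M k y.
  apply/MP => l lk; rewrite ltnNge; apply/negP => yl.
  (* Otherwise the orders other than [k] and [l] already yield all of [B], but there are only
     [#|B| - 1] of them. *)
  have /subset_leq_card : B \subset mu @: (~: [set k; l]).
    apply/subsetP => b /lowP[l' -> l'P].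
    by rewrite imset_f// !inE negb_or !l'P.
  move/leq_trans/(_ (leq_imset_card _ _)); rewrite leqNgt => /negP; apply.
  rewrite -(ltn_add2l #|[set k; l]|) cardsC cards2 eq_sym lk cardB.
  by rewrite addnC addn2.
have yE : y = top k.
  apply: (@r_inj k); apply/eqP; rewrite eqn_leq top_max//=.
  have [l lt] := domy (top k); suff lk : l = k.
    by move: lt; rewrite lk; apply; rewrite !inE eqxx.
  apply/eqP; apply/negPn/negP => lk; have /MP/(_ l lk) := topM k.
  by rewrite ltnNge lt// !inE muB orbT.
by move: kij; rewrite yE !inE => /orP[] /eqP->; rewrite eqxx; [left|right].
Qed.

(** Pairs of a room and a door in it with colours [[set~ i0]] are counted twice. By rooms, the
    parity is that of the number of rooms with all colours; by doors, only the outer door counts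
    oddly, since a door with a non-slack element lies in an even number of rooms. *)
Theorem scarf : exists A, room A /\ c @: A = setT.
Proof.
pose i0 := c v0.
pose door (B : {set X}) := (c @: B == [set~ i0]) && (#|B|.+1 == #|I|).
suff : odd #|[set A | room A && (c @: A == setT)]|.
  case: (set_0Vmem [set A | room A && (c @: A == setT)]) => [->|[A]].
    by rewrite cards0.
  by rewrite inE => /andP[rA /eqP cA] _; exists A.
have -> : odd #|[set A | room A && (c @: A == setT)]| =
    odd (\sum_(A | room A) #|[set x in A | c @: (A :\ x) == [set~ i0]]|).
  rewrite odd_sum; congr (odd #|pred_of_set _|); apply/setP => A.
  by rewrite !inE; apply: andb_id2l => rA; rewrite odd_doors_of_room.
have -> : \sum_(A | room A) #|[set x in A | c @: (A :\ x) == [set~ i0]]| =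
    \sum_(B | door B) #|[set y | (y \notin B) && room (y |: B)]|.
  under eq_bigr do rewrite -sum1dep_card.
  under [RHS]eq_bigr do rewrite -sum1dep_card.
  rewrite !pair_big_dep/=.
  rewrite (reindex_onto (fun p : {set X} * X => (p.2 |: p.1, p.2))
                        (fun p => (p.1 :\ p.2, p.2))) /=; last first.
    by case=> A x /= /and3P[_ xA _]; rewrite setD1K.
  apply: eq_bigl => -[B y] /=; rewrite xpair_eqE eqxx andbT.
  have [yB|yB] /= := boolP (y \in B).
    rewrite andbF; apply/negbTE/nandP; right.
    by apply: contraTneq yB => <-; rewrite !inE eqxx.
  rewrite setU1K// eqxx andbT !inE eqxx/= /door andbC -andbA; congr (_ && _).
  rewrite /room cardsU1 yB add1n [RHS]andbC -andbA andbb.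
  by case: dominant.
rewrite odd_sum; suff -> : [set B | door B &
    odd #|[set y | (y \notin B) && room (y |: B)]|] = [set e @: [set~ i0]].
  by rewrite cards1.
apply/setP => B; rewrite !inE; apply/andP/eqP => [[/andP[/eqP cB /eqP cardB]]|->].
  apply: contraTeq => neB; have [b0 b0B b0N] : exists2 b, b \in B & b \notin codom e.
    apply/subsetPn; apply: contra neB => /subsetP sB; rewrite -cB -imset_comp.
    apply/eqP; rewrite -[LHS]imset_id; apply: eq_in_imset => x /sB /codomP[k ->].
    by rewrite /= c_slack.
  exact: (inner_door_rooms b0B).
rewrite outer_door_room /door; split=> //; rewrite -imset_comp.
rewrite (eq_imset _ c_slack) imset_id eqxx card_imset; last exact: can_inj c_slack.
by rewrite cardsC1 prednK ?eqxx//; apply/card_gt0P; exists i0.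
Qed.

End Scarf.

(** * From linear orders to lattice points of a simplex *)

(* Ties between keys are broken by [enum_rank]; the slack elements form the
   second summand of [V + I]. *)
Lemma scarf_weak_orders (I V : finType) (key : I -> V -> nat) (c : V -> I) (v0 : V) :
  exists (C : {set I}) (p : I -> V),
    (forall i, i \in C -> c (p i) = i) /\
    (forall y, exists2 i, i \in C & forall j, j \in C -> key i y <= key i (p j)).
Proof.
pose n := #|V|.
have rank_lt (v : V) : enum_rank v < n by [].
pose K i := \max_v key i v.
(* Keys are scaled by [n], so that ranks, all below [n], only break ties. The shift by one keeps 0
   for the own slack element, and [(K i).+2] puts the other slack elements above all of [V]. *)
pose r i (x : V + I) := match x with
  | inl v => (key i v).+1 * n + enum_rank v
  | inr j => if j == i then 0 else (K i).+2 * n + enum_rank j end.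
have n0 : 0 < n by apply/card_gt0P; exists v0.
have rl i v : n <= r i (inl v) < (K i).+2 * n.
  have : key i v <= K i by exact: leq_bigmax.
  have := rank_lt v; rewrite /r; nia.
have r_inj i : injective (r i).
  move=> [v|j] [w|k] /=.
  - move=> /(congr1 (modn^~ n)); rewrite !modnMDl !modn_small//.
    by move=> /ord_inj/enum_rank_inj->.
  - have := rl i v; rewrite /=; case: eqP => _ ?; lia.
  - have := rl i w; rewrite /=; case: eqP => _ ?; lia.
  - case: eqP => [->|_]; case: eqP => [->|_] // ; try nia.
    by move=> /addnI/ord_inj/enum_rank_inj->.
pose c' (x : V + I) := match x with inl v => c v | inr i => i end.
have [| | | |A [/andP[/dominantP domA _] cA]] :=
    @scarf _ _ r inr c' r_inj _ _ _ (inl v0).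
- by move=> i y; rewrite /= eqxx.
- move=> i j [v|k] ji; last by rewrite codom_f.
  by move=> _; have /andP[_] := rl i v; rewrite /= (negbTE ji); lia.
- by [].
- by apply/codomP => -[].
pose p i := odflt v0 [pick v | (inl v \in A) && (c v == i)].
have pP i : inr i \notin A -> inl (p i) \in A /\ c (p i) = i.
  move=> iA; rewrite /p; case: pickP => [v /andP[vA /eqP//]|noA].
  have : i \in c' @: A by rewrite cA inE.
  case/imsetP => -[v vA iE|j jA ij]; last by rewrite ij jA in iA.
  by have := noA v; rewrite vA iE eqxx.
exists [set i | inr i \notin A], p; split=> [i|y].
  by rewrite inE => /pP[].
have [i iy] := domA (inl y); exists i.
  rewrite inE; apply/negP => /iy.
  by rewrite /= eqxx; have := rl i y; rewrite /=; lia.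
move=> j; rewrite inE => /pP[pA _]; have /= := iy _ pA.
apply: contraTT; rewrite -!ltnNge => lt_key.
apply: (@leq_trans ((key i (p j)).+2 * n)).
  by rewrite -addnS [leqRHS]mulSnr leq_add2l.
by apply: leq_trans (leq_addr _ _); rewrite leq_mul2r ltnS lt_key orbT.
Qed.

(** If the sum over [C] of the coordinate minima plus one were at most [N], some lattice point would
    exceed every minimum on [C], against dominance. Hence, for each point, the excesses over the
    minima and the coordinates outside [C] total less than [#|C|]. *)
Lemma scarf_grid (I : finType) (N : nat) (c : {ffun I -> 'I_N.+1} -> I) (i0 : I) :
  exists (C : {set I}) (p : I -> {ffun I -> 'I_N.+1}),
    [/\ C != set0,
        forall i, i \in C -> c (p i) = i,
        forall i, i \in C -> \sum_k p i k = N,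
        forall i k, i \in C -> k \notin C -> p i k < #|I| &
        forall i j k, i \in C -> j \in C -> p i k < p j k + #|I|].
Proof.
pose grid (x : {ffun I -> 'I_N.+1}) := \sum_k x k == N.
pose V := {x | grid x}.
have [v0 _] : exists v : V, true.
  suff vP : grid [ffun k => inord (if k == i0 then N else 0)].
    by exists (exist grid _ vP).
  rewrite /grid (bigD1 i0)//= ffunE eqxx inordK// big1 ?addn0// => k ki0.
  by rewrite ffunE (negbTE ki0) inordK.
have [C [q [cq domq]]] :=
  @scarf_weak_orders I V (fun i v => val v i) (fun v => c (val v)) v0.
exists C, (fun i => val (q i)).
have [i1 i1C _] := domq v0.
pose m k := val (q [arg min_(j < i1 in C) val (q j) k]) k : nat.
have mP k : exists2 j, j \in C & m k = val (q j) k.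
  by rewrite /m; case: arg_minnP => // j jC _; exists j.
have m_min j k : j \in C -> m k <= val (q j) k.
  by rewrite /m; case: arg_minnP => // j' j'C; apply.
have sumq j : \sum_k val (q j) k = N := eqP (valP (q j)).
have big_m : N < \sum_(k in C) (m k).+1.
  rewrite ltnNge; apply/negP => le_N.
  rewrite (bigD1 i1)//= in le_N.
  set s := (X in _ + X <= _) in le_N.
  (* Coordinate [i1] absorbs the remainder, which is at least [(m i1).+1] by [le_N]. *)
  pose y0 k := if k == i1 then N - s else if k \in C then (m k).+1 else 0.
  have sumy0 : \sum_k y0 k = N.
    rewrite (bigD1 i1)//= {1}/y0 eqxx.
    suff -> : \sum_(i | i != i1) y0 i = s by lia.
    rewrite /s [RHS]big_mkcondl/=; apply: eq_bigr => k ki1.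
    by rewrite /y0 (negbTE ki1).
  have y0_lt k : y0 k < N.+1.
    by rewrite ltnS -[X in _ <= X]sumy0 (bigD1 k)//= leq_addr.
  have yP : \sum_k ([ffun k => Ordinal (y0_lt k)] : {ffun I -> 'I_N.+1}) k == N.
    by rewrite -[X in _ == X]sumy0; apply/eqP/eq_bigr => k _; rewrite ffunE.
  have [i iC iy] := domq (exist grid _ yP).
  have [j jC mE] := mP i; have := iy _ jC; rewrite -mE /= ffunE/= /y0 iC.
  by case: eqP => [->|_]; lia.
have bound j k : j \in C -> (if k \in C then val (q j) k - m k else val (q j) k) < #|I|.
  move=> jC; pose d k := if k \in C then val (q j) k - m k else val (q j) k : nat.
  apply: (@leq_trans (\sum_k d k).+1).
    by rewrite ltnS (bigD1 k)//= leq_addr.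
  have sumE : \sum_k d k + \sum_(k in C) m k = N.
    rewrite [X in _ + X]big_mkcond -big_split/= -(sumq j); apply: eq_bigr => i _.
    by rewrite /d; case: ifP => _; rewrite ?addn0// subnK// m_min.
  move: big_m; under eq_bigr do rewrite -addn1.
  rewrite big_split/= sum1_card -[X in X < _]sumE addnC ltn_add2l.
  by move/leq_trans; apply; exact: max_card.
split.
- by apply/set0Pn; exists i1.
- exact: cq.
- by move=> i _.
- by move=> i k iC kC; have := bound i k iC; rewrite (negbTE kC).
- move=> i j k iC jC; have := bound i k iC; case: ifP => _ lt_pi.
    rewrite (leq_trans _ (leq_add (m_min j k jC) (leqnn _)))//.
    by rewrite -ltn_subLR// m_min.
  exact: leq_trans lt_pi (leq_addl _ _).
Qed.

(** * Covers of the simplex *)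

(* Only now, because classical sets shadow the finite set notations. *)
Require Import Defs.
From mathcomp Require Import all_order all_fingroup all_algebra.
From mathcomp Require Import all_classical all_reals all_analysis lra.
Import Order.TTheory GRing.Theory Num.Theory.
Import numFieldNormedType.Exports.
Local Open Scope classical_set_scope.
Local Open Scope ring_scope.

Lemma cvg_sumr (M : TopologicalNmodule.type) (I : finType) (P : pred I) T
    (F : set_system T) {FF : Filter F} (f : I -> T -> M) (a : I -> M) :
  (forall i, P i -> f i @ F --> a i) ->
  \sum_(i | P i) f i x @[x --> F] --> \sum_(i | P i) a i.
Proof. by move=> fa; apply: cvg_big => //; exact: add_continuous. Qed.

Definition simplex (R : realType) (m : nat) : set 'rV[R]_m :=
  [set l | (forall k, 0 <= l ord0 k) /\ \sum_k l ord0 k = 1].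
Arguments simplex : clear implicits.

Lemma simplex_le1 (R : realType) m (l : 'rV[R]_m) k :
  simplex R m l -> l ord0 k <= 1.
Proof. by case=> l0 <-; rewrite (bigD1 k)//= lerDl sumr_ge0. Qed.

Lemma compact_simplex (R : realType) m : compact (simplex R m).
Proof.
have -> : simplex R m =
    [set l : 'rV[R]_m | forall k, `[0, 1]%classic (l ord0 k)] `&`
    (fun l : 'rV[R]_m => \sum_k l ord0 k) @^-1` [set x | x = 1].
  apply/seteqP; split=> [l lS|l [/= l01 l1]]; split=> //=.
  - by move=> k; rewrite in_itv/= simplex_le1// lS.1.
  - exact: lS.2.
  - by move=> k; have := l01 k; rewrite /= in_itv/= => /andP[].
apply: compact_closedI.
  have := @rV_compact R m (fun=> `[0, 1]%classic) (fun=> @segment_compact R 0 1). exact.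
apply: preimage_closed; last exact: closed_eq.
by move=> l _; apply: (@cvg_sumr _ _ _ _ (nbhs l)) => k _; exact: coord_continuous.
Qed.

(* A dual of the KKM lemma for the closed sets [0 <= h i], equivalent to Brouwer's
   theorem: the cells given by [scarf_grid] accumulate at some [l]. *)
Lemma simplex_dual_kkm (R : realType) m (h : 'I_m -> 'rV[R]_m -> R) :
  (0 < m)%N ->
  (forall i, {within simplex R m, continuous (h i)}) ->
  (forall l, simplex R m l -> exists i, 0 <= h i l) ->
  exists2 l, simplex R m l & forall i, 0 < l ord0 i -> 0 <= h i l.
Proof.
move=> m0 hc hcover; apply: contrapT => nosol.
have {}nosol l : simplex R m l -> exists2 i, 0 < l ord0 i & h i l < 0.
  move=> lS; apply: contrapT => noi; apply: nosol; exists l => // i li.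
  by rewrite leNgt; apply/negP => hi; apply: noi; exists i.
pose eps (N : nat) : R := m%:R / N.+1%:R.
(* No cell of mesh [eps N] has [l] as a vertex. By compactness this holds on the whole simplex for
   large [N], and the grid then contradicts it. *)
pose P (N : nat) (l : 'rV[R]_m) := forall (C : {set 'I_m}) (p : 'I_m -> 'rV[R]_m),
  (forall i, i \in C -> simplex R m (p i) /\ 0 <= h i (p i)) ->
  (forall i k, i \in C -> k \notin C -> p i ord0 k < eps N) ->
  (forall i j k, i \in C -> j \in C -> p i ord0 k < p j ord0 k + eps N) ->
  forall j, j \in C -> p j <> l.
have : \forall N \near \oo, simplex R m `<=` P N.
  have /compact_near_coveringP := @compact_simplex R m; apply => l lS.
  have [i li0 hi0] := nosol l lS.
  have /cvgr_lt/(_ 0 hi0) := (iffLR (subspace_continuousP _ _) (hc i)) l lS.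
  rewrite near_withinE => /nbhs_ballP[d d0 hd].
  (* Halving leaves room for two steps below [e], from [l] to [p j] and on to [p i]; the bound by
     [l ord0 i] forces [i] into [C]. *)
  pose e := Num.min d (l ord0 i) / 2.
  have e0 : 0 < e by rewrite divr_gt0// lt_min d0.
  have eps_small : \forall N \near \oo, eps N < e.
    have mr : 0 < m%:R :> R by rewrite ltr0n.
    have em : 0 < e / m%:R by rewrite divr_gt0.
    near=> N; rewrite /eps -ltr_pdivlMl// mulrC.
    near: N; exact: (near_infty_natSinv_lt (PosNum em)).
  near=> l' N => C p pS pC pd j jC pjl.
  have eN : eps N < e by near: N.
  have ll' : ball l e l' by near: l'; exact: nbhsx_ballx.
  have ed : e + e <= d by rewrite -splitr ge_min lexx.
  have el : e + e <= l ord0 i by rewrite -splitr ge_min lexx orbT.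
  have coord k : `|l ord0 k - p j ord0 k| < e by rewrite pjl; exact: ll'.2.
  have [iC|iC] := boolP (i \in C); last first.
    have := pC j i jC iC; have := coord i; rewrite ltr_norml => /andP[_]; lra.
  have [piS hpi] := pS i iC; have : h i (p i) < 0.
    apply: hd => //; split=> [|a k]; first by lra.
    rewrite (ord1 a) /ball/= ltr_norml; have := coord k; rewrite ltr_norml.
    have := pd i j k iC jC; have := pd j i k jC iC => + + /andP[]; lra.
  by rewrite ltNge hpi.
case=> N _ /(_ N (leqnn N)) NP.
pose x (v : {ffun 'I_m -> 'I_N.+2}) : 'rV[R]_m := \row_k ((v k)%:R / N.+1%:R).
(* By [hcover], the default colour occurs only off the simplex. *)
pose c v := odflt (Ordinal m0) [pick i | 0 <= h i (x v)].
have [C [p [/set0Pn[i0 i0C] cp p_sum pC pd]]] := scarf_grid c (Ordinal m0).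
have N0 : 0 < N.+1%:R :> R by rewrite ltr0n.
have xS i : i \in C -> simplex R m (x (p i)).
  move=> iC; split=> [k|]; first by rewrite mxE divr_ge0.
  under eq_bigr do rewrite mxE.
  by rewrite -mulr_suml -natr_sum p_sum// divff ?lt0r_neq0.
apply: (NP _ (xS _ i0C) C (x \o p)) i0C _ => //.
- move=> i iC /=; split; first exact: xS.
  have := cp i iC; rewrite /c; case: pickP => [j hj /= jE|noj]; first by rewrite -{1}jE.
  by have [j hj] := hcover _ (xS i iC); have := noj j; rewrite hj.
- move=> i k iC kC; rewrite /= mxE /eps ltr_pM2r ?invr_gt0// ltr_nat.
  by have := pC i k iC kC; rewrite card_ord.
- move=> i j k iC jC; rewrite /= !mxE /eps -mulrDl ltr_pM2r ?invr_gt0//.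
  by rewrite -natrD ltr_nat; have := pd i j k iC jC; rewrite card_ord.
Unshelve. all: by end_near. Qed.

(** On the simplex the [h i] below sum to zero, so one of them is nonnegative and [simplex_dual_kkm]
    applies. At the resulting [l], a positive [S l] would make [f i l] positive wherever [l] is,
    against the bound on the weighted sum; and [S l <= 0] bounds every [f k l]. *)
Lemma simplex_variational (R : realType) m (f : 'I_m -> 'rV[R]_m -> R) :
  (0 < m)%N ->
  (forall i, {within simplex R m, continuous (f i)}) ->
  (forall l, simplex R m l -> \sum_k l ord0 k * f k l <= 0) ->
  exists2 l, simplex R m l & forall k, f k l <= 0.
Proof.
move=> m0 fc f0.
(* [h] is, up to a positive factor, the displacement of Brouwer's map
   [(l + f^+) / (1 + S)], with [f^+] the positive part of [f]. *)
pose S l := \sum_j Num.max (f j l) 0.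
pose h i l := Num.max (f i l) 0 - l ord0 i * S l.
have maxc i l : simplex R m l ->
    Num.max (f i l') 0 @[l' --> within (simplex R m) (nbhs l)] --> Num.max (f i l) 0.
  move=> lS; have fi := (iffLR (subspace_continuousP _ _) (fc i)) l lS.
  under eq_fun do rewrite maxr_absE; rewrite maxr_absE.
  apply: cvgM; last exact: cvg_cst.
  apply: cvgD; first by apply: cvgD => //; exact: cvg_cst.
  by apply: cvg_norm; apply: cvgB => //; exact: cvg_cst.
have Sc l : simplex R m l -> S l' @[l' --> within (simplex R m) (nbhs l)] --> S l.
  by move=> lS; apply: cvg_sumr => i _; exact: maxc.
have [|l lS|l lS hl] := @simplex_dual_kkm R m h m0.
- move=> i; apply/subspace_continuousP => l lS.
  apply: cvgB; first exact: maxc.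
  apply: cvgM; last exact: Sc.
  by apply: cvg_within_filter; exact: coord_continuous.
- apply: contrapT => noi; have hlt i : h i l < 0.
    by rewrite ltNge; apply/negP => hi; apply: noi; exists i.
  suff : \sum_i h i l = 0.
    apply/eqP; rewrite lt_eqF// (bigD1 (Ordinal m0))//=.
    by rewrite ltr_wnDr// sumr_le0// => i _; exact: ltW.
  by rewrite big_split/= sumrN -mulr_suml lS.2 mul1r subrr.
exists l => // k; have [Sl|Sl] := ltP 0 (S l); last first.
  apply: le_trans Sl; rewrite /S (bigD1 k)//=.
  rewrite (le_trans (_ : _ <= Num.max (f k l) 0)) ?le_max ?lexx//.
  by rewrite lerDl sumr_ge0// => i _; rewrite le_max lexx orbT.
have lf i : 0 < l ord0 i -> 0 < f i l.
  move=> li; have := hl i li; rewrite /h subr_ge0 => /(lt_le_trans (mulr_gt0 li Sl)).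
  by rewrite lt_max ltxx orbF.
have lf0 i : 0 <= l ord0 i * f i l.
  have := lS.1 i; rewrite le_eqVlt => /predU1P[<-|li]; first by rewrite mul0r.
  by rewrite ltW// mulr_gt0// lf.
have [i li] : exists i, 0 < l ord0 i.
  apply: contrapT => noi; have : \sum_i l ord0 i = 1 := lS.2.
  rewrite big1 => [/eqP|i _]; first by rewrite eq_sym oner_eq0.
  apply/eqP; rewrite eq_le lS.1 andbT leNgt; apply/negP => li; apply: noi.
  by exists i.
have := f0 l lS; rewrite leNgt (bigD1 i)//= ltr_pwDl//; first by rewrite mulr_gt0// lf.
by apply: sumr_ge0.
Qed.

(** * Continuity of maps into products, and convex combinations *)

Lemma within_continuous_comp_sub (X Y Z : topologicalType) (A : set X)
    (B : set Y) (f : X -> Y) (g : Y -> Z) :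
  continuous f -> (forall x, A x -> B (f x)) ->
  {within B, continuous g} -> {within A, continuous (g \o f)}.
Proof.
move=> fc AB /subspace_continuousP gc; apply/subspace_continuousP => x Ax U gU.
apply: (@filterS _ (nbhs x) _ _ _ _ (fc x _ (gc (f x) (AB _ Ax) U gU))).
by move=> z /= gz Az; exact: gz (AB _ Az).
Qed.

Lemma ptws_continuous (X : topologicalType) (I : Type) (Y : topologicalType)
    (q : X -> {ptws I -> Y}) :
  (forall i, continuous (fun x => q x i)) -> continuous q.
Proof.
move=> qc x; apply/cvg_sup => i U [V] [[W] oW <-] /= qW WU.
apply: (filterS WU); rewrite nbhs_simpl /=.
exact: (qc i x W (open_nbhs_nbhs (conj oW qW))).
Qed.

Lemma ptws_coord_continuous (I : eqType) (Y : topologicalType) (i : I) :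
  continuous (fun x : {ptws I -> Y} => x i).
Proof. exact: (@proj_continuous I (fun=> Y) i). Qed.

(** Jensen's inequality, by splitting off the first point and renormalising the other weights.
    Membership in [D] is part of the induction because convexity is applied at the average of the
    tail. *)
Lemma convex_function_sum (R : realType) (E : lmodType R) (D : set E) (f : E -> R) :
  convex_set D -> convex_function D f ->
  forall m (w : 'I_m -> R) (y : 'I_m -> E),
  (forall k, 0 <= w k) -> \sum_k w k = 1 -> (forall k, D (y k)) ->
  D (\sum_k w k *: y k) /\ f (\sum_k w k *: y k) <= \sum_k w k * f (y k).
Proof.
move=> cD cf; elim=> [|m IHm] w y w0 w1 Dy.
  by move: w1; rewrite big_ord0 => /eqP; rewrite eq_sym oner_eq0.
rewrite !big_ord_recl; set w' := fun k => w (lift ord0 k).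
have w'1 : \sum_k w' k = 1 - w ord0.
  by move: w1; rewrite big_ord_recl => <-; rewrite addrAC subrr add0r.
have [w00|w0N] := eqVneq (w ord0) 1.
  have w'0 k : w' k = 0.
    move: w'1; rewrite w00 subrr => /eqP; rewrite psumr_eq0 => [|j _]; last exact: w0.
    by move=> /allP/(_ k (mem_index_enum _))/eqP.
  rewrite !big1 ?addr0 ?w00 ?scale1r ?mul1r; first by split.
  - by move=> k _; rewrite -/(w' k) w'0 mul0r.
  - by move=> k _; rewrite -/(w' k) w'0 scale0r.
have w0le : w ord0 <= 1.
  by rewrite -w1 big_ord_recl lerDl sumr_ge0.
have v0 : 0 < 1 - w ord0 by rewrite subr_gt0 lt_neqAle w0N.
have [|||Dz fz] := IHm (fun k => w' k / (1 - w ord0)) (fun k => y (lift ord0 k)).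
- by move=> k; rewrite divr_ge0 ?w0 ?ltW.
- by rewrite -mulr_suml w'1 divff// gt_eqF.
- by move=> k; exact: Dy.
set z := \sum_k _ in Dz fz.
have zE : \sum_i w' i *: y (lift ord0 i) = (1 - w ord0) *: z.
  rewrite scaler_sumr; apply: eq_bigr => k _.
  by rewrite scalerA mulrCA divff ?mulr1// gt_eqF.
have fzE : \sum_i w' i * f (y (lift ord0 i)) =
    (1 - w ord0) * \sum_k w' k / (1 - w ord0) * f (y (lift ord0 k)).
  rewrite mulr_sumr; apply: eq_bigr => k _.
  by rewrite mulrA (mulrCA (1 - w ord0)) divff ?mulr1// gt_eqF.
rewrite zE fzE.
pose t := Itv01 (w0 ord0) w0le.
split; first by have := cD (y ord0) z t; rewrite !inE; apply.
apply: le_trans (_ : w ord0 * f (y ord0) + (1 - w ord0) * f z <= _); last first.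
  by rewrite lerD2l ler_pM2l.
by have := cf t (y ord0) z; rewrite !inE; apply.
Qed.

Lemma convex_set_sum (R : realType) (E : lmodType R) (D : set E) :
  convex_set D -> forall m (w : 'I_m -> R) (y : 'I_m -> E),
  (forall k, 0 <= w k) -> \sum_k w k = 1 -> (forall k, D (y k)) ->
  D (\sum_k w k *: y k).
Proof.
move=> cD m w y w0 w1 Dy.
have c0 : convex_function D (fun=> 0 : R) by move=> t a b _ _; rewrite convmm.
by have [] := convex_function_sum cD c0 w0 w1 Dy.
Qed.

(** * Ky Fan's inequality and continuity of minima *)

Lemma compact_profiles (R : realType) (E : topologicalLmodType R) n (T : set E) :
  compact T -> compact (@profiles R E n T).
Proof. by move=> cT; exact: (@tychonoff 'I_n (fun=> E) (fun=> T) (fun=> cT)). Qed.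

(* The last hypothesis is what is used of the concavity of [phi x] and of
   [phi x x <= 0]. *)
Theorem ky_fan (R : realType) (E : topologicalLmodType R) n (T : set E)
    (phi : {ptws 'I_n -> E} -> {ptws 'I_n -> E} -> R) :
  compact T -> convex_set T -> @profiles R E n T !=set0 ->
  (forall y, profiles T y -> {within profiles T, continuous (phi^~ y)}) ->
  (forall m (l : 'I_m -> R) (y : 'I_m -> {ptws 'I_n -> E}),
    (forall k, 0 <= l k) -> \sum_k l k = 1 -> (forall k, profiles T (y k)) ->
    \sum_k l k * phi (fun i => \sum_j l j *: y j i) (y k) <= 0) ->
  exists2 x, profiles T x & forall y, profiles T y -> phi x y <= 0.
Proof.
move=> cT convT [x0 x0T] phic phi0; apply: contrapT => nosol.
have {}nosol x : profiles T x -> exists2 y, profiles T y & 0 < phi x y.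
  move=> xT; apply: contrapT => noy; apply: nosol; exists x => // y yT.
  by rewrite leNgt; apply/negP => xy; apply: noy; exists y.
(* Eventuality along the finite sets of profiles, directed by inclusion. *)
pose Y := {ptws 'I_n -> E}.
pose FS : set_system (seq Y) := [set A : set (seq Y) | exists2 s0 : seq Y,
  (forall y, y \in s0 -> profiles T y) &
  forall s : seq Y, (forall y, y \in s -> profiles T y) -> {subset s0 <= s} -> A s].
have FF : Filter FS.
  split=> [|A B [s sT sA] [t tT tB]|A B AB [s sT sA]].
  - by exists [::].
  - exists (s ++ t) => [y|r rT str]; first by rewrite mem_cat => /orP[/sT|/tT].
    split; [apply: sA => // y ys|apply: tB => // y yt]; apply: str.
      by rewrite mem_cat ys.
    by rewrite mem_cat yt orbT.
  - by exists s => // r rT /sA sr; exact/AB/sr.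
pose P (s : seq Y) (x : Y) := exists2 y, y \in s & 0 < phi x y.
(* By continuity, a [y] with [0 < phi x y] also serves near [x]; compactness gives one finite list
   [s] for all profiles. *)
have : \forall s \near FS, profiles T `<=` P s.
  have /compact_near_coveringP/near_covering_withinP := @compact_profiles R E n T cT.
  apply => // x xT; have [y yT xy] := nosol x xT.
  have /cvgr_gt/(_ 0 xy) := (iffLR (subspace_continuousP _ _) (phic y yT)) x xT.
  rewrite near_withinE => phi_gt.
  exists ([set x' | profiles T x' -> 0 < phi x' y], [set s : seq Y | y \in s]).
    split=> //=; exists [:: y] => [z|s _]; first by rewrite inE => /eqP->.
    by apply; rewrite inE.
  by case=> x' s [/= x'y ys] x'T; exists y => //; exact: x'y.
case=> s sT /(_ s sT (fun=> id)) sP.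
pose y (k : 'I_(size s)) := nth x0 s k.
have yT k : profiles T (y k) by apply: sT; exact: mem_nth.
pose comb (l : 'rV[R]_(size s)) : {ptws 'I_n -> E} :=
  fun i => \sum_k l ord0 k *: y k i.
have combc : continuous comb.
  apply: ptws_continuous => i l.
  apply: (@cvg_sumr _ _ _ _ (nbhs l)) => k _.
  apply: (@continuous2_cvg _ R^o E E (nbhs l) _ _ _ (fun (a : R^o) (b : E) => a *: b)).
  - exact: (@scale_continuous R E (l ord0 k, y k i)).
  - exact: coord_continuous.
  - exact: cvg_cst.
have combT l : simplex R (size s) l -> profiles T (comb l).
  by move=> [l0 l1] i; have := convex_set_sum convT l0 l1 (fun k => yT k i).
have s0 : (0 < size s)%N.
  by have [z zs _] := sP x0 x0T; rewrite -has_predT; apply/hasP; exists z.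
have [k|l lS|l lS fl] := @simplex_variational R _ (fun k l => phi (comb l) (y k)) s0.
- exact: (@within_continuous_comp_sub _ _ _ _ _ comb (phi^~ (y k)) combc combT
    (phic _ (yT k))).
- exact: phi0 lS.1 lS.2 yT.
have [z zs] := sP _ (combT l lS).
have zi : (index z s < size s)%N by rewrite index_mem.
have := fl (Ordinal zi); rewrite /y /= nth_index// => le0.
by move=> /lt_le_trans/(_ le0); rewrite ltxx.
Qed.

(** A fixed minimiser for [x] keeps [w] from jumping up near [x]. That [w] does not drop uses
    compactness of [K], which makes the lower bounds uniform over [K]. *)
Lemma min_continuous (R : realType) (X Y : topologicalType) (A : set X)
    (K : set Y) (g : Y -> X -> R) (w : X -> R) :
  compact K -> {within K `*` A, continuous (fun z => g z.1 z.2)} ->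
  (forall x, A x -> minima [set g y x | y in K] (w x)) ->
  {within A, continuous w}.
Proof.
move=> cK /subspace_continuousP gc wmin; apply/subspace_continuousP => x Ax.
have [[y Ky gy] xlb] := wmin x Ax.
apply/cvgrPdist_lt => e e0.
have up : \forall x' \near x, A x' -> w x' < w x + e.
  have gxy : g y x < w x + e by rewrite gy ltrDl.
  have /cvgr_lt/(_ _ gxy) := gc (y, x) (conj Ky Ax); rewrite near_withinE.
  case=> -[U V] /= [Uy Vx] UV; apply: filterS Vx => x' Vx' Ax'.
  apply: le_lt_trans (UV (y, x') (conj (nbhs_singleton Uy) Vx') (conj Ky Ax')).
  by have [_ lb] := wmin x' Ax'; apply: lb; exists y.
have low : \forall x' \near x, K `<=` (fun y' => A x' -> w x - e < g y' x').
  have /compact_near_coveringP/near_covering_withinP := cK; apply => y' Ky'.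
  have gxy : w x - e < g y' x.
    by apply: lt_le_trans (_ : w x <= _); [rewrite ltrBlDr ltrDl|apply: xlb; exists y'].
  have /cvgr_gt/(_ _ gxy) := gc (y', x) (conj Ky' Ax); rewrite near_withinE.
  by apply: filterS => -[y1 x1] /= gt Ky1 Ax1; exact: gt.
rewrite near_withinE; near=> x' => Ax'.
have [[y' Ky' gy'] _] := wmin x' Ax'.
have lo : w x - e < w x' by rewrite -gy'; apply: (near low x').
have hi : w x' < w x + e by apply: (near up x').
by rewrite /from_subspace ltr_distlC lo hi.
Unshelve. all: by end_near. Qed.

(** * The game *)

Section WorstCase.
Variables (R : realType) (E : topologicalLmodType R) (n : nat).
Variables (T : set E) (tau : E) (u : 'I_n -> {ptws 'I_n -> E} -> R).
Hypotheses (Ttau : T tau) (convT : convex_set T) (compT : compact T).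
Variables (F G : {set 'I_n}).
Implicit Types (x s : {ptws 'I_n -> E}) (i : 'I_n).

(** The default 0 is reserved for the case where no minimum is attained; [worst_payoff_minima] rules
    it out for [i] in [G] and [x] in [profiles T]. *)
Definition worst_payoff i x : R :=
  xget 0 (minima [set u i (concat tau F G s x) | s in profiles T]).

Lemma profiles_dfwith x i t : profiles T x -> T t -> profiles T (dfwith x i t).
Proof. by move=> xT tT j; case: dfwithP. Qed.

Lemma profiles_concat s x : profiles T s -> profiles T x ->
  profiles T (concat tau F G s x).
Proof. by move=> sT xT j; rewrite /concat; do 2?case: ifP. Qed.

Lemma concat_continuous :
  continuous (fun z : {ptws 'I_n -> E} * {ptws 'I_n -> E} => concat tau F G z.1 z.2).
Proof.
apply: ptws_continuous => j z; rewrite /concat; case: (j \in F); last case: (j \in G).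
- apply: (@cvg_comp _ _ _ fst (fun x : {ptws 'I_n -> E} => x j) (nbhs z) (nbhs z.1)).
    exact: cvg_fst.
  exact: ptws_coord_continuous.
- apply: (@cvg_comp _ _ _ snd (fun x : {ptws 'I_n -> E} => x j) (nbhs z) (nbhs z.2)).
    exact: cvg_snd.
  exact: ptws_coord_continuous.
- exact: cvg_cst.
Qed.

Lemma dfwith_profile_continuous i t :
  continuous (fun x : {ptws 'I_n -> E} => dfwith x i t : {ptws 'I_n -> E}).
Proof.
apply: ptws_continuous => j; have [->|ji] := eqVneq j i.
  have -> : (fun x : {ptws 'I_n -> E} => (dfwith x i t : {ptws 'I_n -> E}) i) = fun=> t.
    by apply/funext => x; rewrite dfwithin.
  exact: cst_continuous.
have -> : (fun x : {ptws 'I_n -> E} => (dfwith x i t : {ptws 'I_n -> E}) j) =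
    fun x : {ptws 'I_n -> E} => x j.
  by apply/funext => x; rewrite dfwithout// eq_sym.
exact: ptws_coord_continuous.
Qed.

Hypothesis contu : continuous_payoffs T u G.

Lemma payoff_concat_continuous i : i \in G ->
  {within profiles T `*` profiles T,
    continuous (fun z => u i (concat tau F G z.1 z.2))}.
Proof.
move=> iG; apply: (@within_continuous_comp_sub _ _ _ _ (profiles T) _ (u i)
  concat_continuous).
  by move=> [s x] [/= sT xT]; exact: profiles_concat.
exact: contu.
Qed.

Lemma worst_payoff_minima i x : i \in G -> profiles T x ->
  minima [set u i (concat tau F G s x) | s in profiles T] (worst_payoff i x).
Proof.
move=> iG xT; apply: (@xgetPex _ 0).
have [|||c] := @compact_EVT_min _ R (fun s => u i (concat tau F G s x))
  (@profiles R E n T).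
- by exists (fun=> tau).
- exact: compact_profiles.
- apply: (@within_continuous_comp_sub _ _ _ _ (profiles T `*` profiles T)
    (fun s => (s, x)) _ _ _ (payoff_concat_continuous iG)) => //.
  move=> s; apply: (@cvg_pair _ _ _ (nbhs s) (nbhs s) (nbhs x) _ _ _ id (cst x)).
    exact: cvg_id.
  exact: cvg_cst.
rewrite inE => cT cmin; exists (u i (concat tau F G c x)); split; first by exists c.
by move=> _ [s sT <-]; apply: cmin; rewrite inE.
Qed.

Lemma worst_payoff_continuous i : i \in G ->
  {within profiles T, continuous (worst_payoff i)}.
Proof.
move=> iG; apply: (@min_continuous R _ _ (profiles T) (profiles T)
  (fun s x => u i (concat tau F G s x))).
- exact: compact_profiles.
- exact: payoff_concat_continuous.
- by move=> x xT; exact: worst_payoff_minima.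
Qed.

Hypothesis disFG : [disjoint F & G]%B.

Lemma concat_dfwith i s x t : i \in G ->
  concat tau F G s (dfwith x i t) = dfwith (concat tau F G s x) i t.
Proof.
move=> iG; apply/funext => j; rewrite /concat.
have [->|ji] := eqVneq j i; last by rewrite !dfwithout 1?eq_sym.
by rewrite !dfwithin (disjointFl disFG iG) iG.
Qed.

Hypothesis concu : concave_payoffs T tau u F G.

(** A minimum of concave functions is concave: the Byzantine answer that is worst against the
    averaged strategy is also available against each [t k]. *)
Lemma worst_payoff_concave i x m (l : 'I_m -> R) (t : 'I_m -> E) :
  i \in G -> profiles T x ->
  (forall k, 0 <= l k) -> \sum_k l k = 1 -> (forall k, T (t k)) ->
  \sum_k l k * worst_payoff i (dfwith x i (t k)) <=
  worst_payoff i (dfwith x i (\sum_k l k *: t k)).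
Proof.
move=> iG xT l0 l1 tT.
have convex_at s : profiles T s -> convex_function T
    (fun t => - u i (dfwith (concat tau F G s x) i t)).
  move=> sT; apply: concu => //; split; first exact: profiles_concat.
  by move=> j; rewrite inE negb_or /concat => /andP[/negbTE-> /negbTE->].
have sumT := convex_set_sum convT l0 l1 tT.
have [[s sT <-] _] := worst_payoff_minima iG (profiles_dfwith i xT sumT).
have [_] := convex_function_sum convT (convex_at s sT) l0 l1 tT.
rewrite concat_dfwith// lerNl; apply: le_trans.
rewrite -sumrN; apply: ler_sum => k _; rewrite mulrN opprK ler_wpM2l//.
have [_ lb] := worst_payoff_minima iG (profiles_dfwith i xT (tT k)).
by apply: lb; exists s; rewrite ?concat_dfwith.
Qed.

Lemma dfwith_id x i : dfwith x i (x i) = x.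
Proof. by apply/funext => j; case: dfwithP. Qed.

Lemma BARNE_existence : exists sG : 'I_n -> E, BARNE T tau u F G sG.
Proof.
have [|||x xT xP] := @ky_fan R E n T (fun x y =>
  \sum_(i in G) (worst_payoff i (dfwith x i (y i)) - worst_payoff i x)) compT convT.
- by exists (fun=> tau).
- move=> y yT; apply/subspace_continuousP => x xT.
  apply: cvg_sumr => i iG; apply: cvgB; last first.
    exact: (iffLR (subspace_continuousP _ _) (worst_payoff_continuous iG)).
  have := @within_continuous_comp_sub _ _ _ _ _ _ _ (@dfwith_profile_continuous i (y i))
    (fun x xT => profiles_dfwith i xT (yT i)) (worst_payoff_continuous iG).
  by move=> /subspace_continuousP; apply.
- move=> m l y l0 l1 yT; pose x : {ptws 'I_n -> E} := fun i => \sum_j l j *: y j i.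
  rewrite -/x.
  (* Exchanging the sums leaves, for each agent, concavity in its own strategy at the averaged
     profile. *)
  under eq_bigr do rewrite mulr_sumr; rewrite exchange_big/=.
  apply: sumr_le0 => i iG; under eq_bigr do rewrite mulrBr.
  rewrite sumrB -mulr_suml l1 mul1r subr_le0.
  have xT : profiles T x.
    by move=> j; have := convex_set_sum convT l0 l1 (fun k => yT k j).
  rewrite -[leRHS]/(worst_payoff i x) -[in leRHS](dfwith_id x i).
  exact: (worst_payoff_concave iG xT l0 l1 (fun k => yT k i)).
exists x => i iG; exists (fun t => worst_payoff i (dfwith x i t)).
  by move=> t tT; exact: worst_payoff_minima (profiles_dfwith i xT tT).
split=> // t tT; rewrite dfwith_id -subr_le0.
(* The test profile changes only the strategy of [i], so the terms of the other agents vanish. *)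
have := xP _ (profiles_dfwith i xT tT); rewrite (bigD1 i)//= dfwithin big1 ?addr0//.
by move=> j /andP[_ ji]; rewrite dfwithout 1?eq_sym// dfwith_id subrr.
Qed.

(** As [ky_fan] speaks of profiles, a single strategy is encoded as coordinate [i] of a profile and
    spread to all agents by [cst]. *)
Lemma symmetric_best_response i : i \in G ->
  exists2 sigma, T sigma &
    forall t, T t ->
      worst_payoff i (dfwith (fun=> sigma) i t) <= worst_payoff i (fun=> sigma).
Proof.
move=> iG; pose cst (t : E) : {ptws 'I_n -> E} := fun=> t.
have cstc : continuous (fun x : {ptws 'I_n -> E} => cst (x i)).
  by apply: ptws_continuous => j; exact: ptws_coord_continuous.
have [|||x xT xP] := @ky_fan R E n T (fun x y =>
  worst_payoff i (dfwith (cst (x i)) i (y i)) - worst_payoff i (cst (x i))) compT convT.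
- by exists (fun=> tau).
- move=> y yT; have dfc : continuous (fun x : {ptws 'I_n -> E} =>
      dfwith (cst (x i)) i (y i) : {ptws 'I_n -> E}).
    move=> x; apply: (@cvg_comp _ _ _ (fun x : {ptws 'I_n -> E} => cst (x i))
      (fun z : {ptws 'I_n -> E} => dfwith z i (y i)) (nbhs x) (nbhs (cst (x i)))).
      exact: cstc.
    exact: dfwith_profile_continuous.
  apply/subspace_continuousP => x xT; apply: cvgB.
    have := @within_continuous_comp_sub _ _ _ (profiles T) _ _ _ dfc
      (fun x xT => profiles_dfwith i (fun=> xT i) (yT i)) (worst_payoff_continuous iG).
    by move=> /subspace_continuousP; apply.
  have := @within_continuous_comp_sub _ _ _ (profiles T) _ _ _ cstc
    (fun x xT => (fun=> xT i)) (worst_payoff_continuous iG).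
  by move=> /subspace_continuousP; apply.
- move=> m l y l0 l1 yT; pose x : {ptws 'I_n -> E} := fun i => \sum_j l j *: y j i.
  rewrite -/x.
  under eq_bigr do rewrite mulrBr.
  rewrite sumrB -mulr_suml l1 mul1r subr_le0.
  have xT : T (x i).
    by have := convex_set_sum convT l0 l1 (fun k => yT k i).
  rewrite -[in leRHS](dfwith_id (cst (x i)) i).
  exact: (worst_payoff_concave iG (fun=> xT) l0 l1 (fun k => yT k i)).
exists (x i) => // t tT; rewrite -subr_le0.
exact: (xP (fun=> t) (fun=> tT)).
Qed.

End WorstCase.

(** * Relabelling the agents *)

(* A permutation preserving this numbering respects [F], [G] and [i]. *)
Definition role n (F G : {set 'I_n}) (i j : 'I_n) : nat :=
  if j \in F then 0 else if j == i then 1 else if j \in G then 2 else 3.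

(** The right-hand side depends only on [n] and the sizes, so configurations of equal sizes have the
    same roles up to order. *)
Lemma perm_eq_role n (F G : {set 'I_n}) (i : 'I_n) :
  [disjoint F & G]%B -> i \in G ->
  perm_eq [seq role F G i j | j <- enum 'I_n]
    (nseq #|F| 0 ++ 1 :: nseq #|G|.-1 2 ++ nseq (n - (#|F| + #|G|)) 3)%N.
Proof.
move=> disFG iG; pose s := enum F ++ i :: enum (G :\ i) ++ enum (~: (F :|: G)).
have iF : i \in F = false := disjointFl disFG iG.
have perm_s : perm_eq (enum 'I_n) s.
  apply: uniq_perm; first exact: enum_uniq.
    rewrite cat_uniq; apply/and3P; split; first exact: enum_uniq.
      apply/hasPn => j; rewrite !(inE, mem_cat, mem_enum).
      have [->|_] := eqVneq j i; first by rewrite iF.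
      by case: (boolP (j \in F)) => // jF; rewrite (disjointFr disFG).
    rewrite cons_uniq cat_uniq !enum_uniq !(mem_cat, mem_enum, inE).
    rewrite eqxx iG orbT /= andbT.
    apply/hasPn => j; rewrite !mem_enum !inE.
    by rewrite negb_or => /andP[_ /negbTE->]; rewrite andbF.
  move=> j; rewrite mem_enum !(mem_cat, inE) !mem_enum !inE.
  by case: (j \in F) => //=; case: eqP => //=; case: (j \in G).
apply: perm_trans (perm_map _ perm_s) _.
rewrite map_cat map_cons map_cat.
suff [-> -> -> ->] : [/\ [seq role F G i j | j <- enum F] = nseq #|F| 0%N,
    role F G i i = 1%N,
    [seq role F G i j | j <- enum (G :\ i)] = nseq #|G|.-1 2%N &
    [seq role F G i j | j <- enum (~: (F :|: G))] = nseq (n - (#|F| + #|G|)) 3%N].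
  exact: perm_refl.
have constE (A : {set 'I_n}) k : (forall j, j \in A -> role F G i j = k) ->
    [seq role F G i j | j <- enum A] = nseq #|A| k.
  move=> Ak; rewrite cardE -(size_map (role F G i)); apply/all_pred1P/allP.
  by move=> r /mapP[j]; rewrite mem_enum => /Ak jk ->; apply/eqP.
split.
- by apply: constE => j jF; rewrite /role jF.
- by rewrite /role iF eqxx.
- rewrite [in RHS](cardsD1 i) iG; apply: constE => j; rewrite !inE => /andP[ji jG].
  by rewrite /role (negbTE ji) jG (disjointFl disFG jG).
- have -> : (n - (#|F| + #|G|))%N = #|~: (F :|: G)|.
    have := cardsC (F :|: G); rewrite card_ord cardsU disjoint_setI0// cards0 subn0.
    by move=> nE; rewrite -[X in (X - _)%N]nE addKn.
  apply: constE => j; rewrite !inE negb_or => /andP[jF jG].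
  rewrite /role (negbTE jF) (negbTE jG); case: eqP jG => // ->.
  by rewrite iG.
Qed.

Lemma role_perm n (F G F' G' : {set 'I_n}) (i i' : 'I_n) :
  [disjoint F & G]%B -> [disjoint F' & G']%B -> i \in G -> i' \in G' ->
  #|F| = #|F'| -> #|G| = #|G'| ->
  exists p : 'S_n, [/\ p i = i', forall j, (p j \in F') = (j \in F) &
    forall j, (p j \in G') = (j \in G)].
Proof.
move=> disFG disFG' iG iG' cF cG.
have := perm_eq_role disFG iG; rewrite cF cG => perm1.
have := perm_eq_role disFG' iG'; rewrite perm_sym => perm2.
have := perm_trans perm1 perm2.
rewrite -[X in perm_eq _ X]/(tval (map_tuple (role F' G' i') (ord_tuple n))).
move=> /tuple_permP[p pE].
have {}pE j : role F G i j = role F' G' i' (p j).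
  have := congr1 (nth 0%N ^~ j) pE.
  rewrite /= (nth_map j) ?size_enum_ord// nth_ord_enum => ->.
  by rewrite (nth_map j) ?size_enum_ord// nth_ord_enum tnth_map tnth_ord_tuple.
have roleF j : (p j \in F') = (j \in F).
  by have := pE j; rewrite /role; do 6!case: ifP => //.
have rolei j : (p j == i') = (j == i).
  have := pE j; rewrite /role roleF.
  have [jF|jF] := boolP (j \in F); last by do 4!case: ifP => //.
  move=> _; transitivity false; [|symmetry]; apply/eqP => jE.
    by move: jF; rewrite -roleF jE (disjointFl disFG' iG').
  by move: jF; rewrite jE (disjointFl disFG iG).
exists p; split=> // [|j]; first by apply/eqP; rewrite rolei.
have [ji|ji] := eqVneq j i.
  by rewrite ji iG; have := rolei i; rewrite eqxx => /eqP->.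
have := pE j; rewrite /role roleF rolei (negbTE ji).
have [jF|jF] := boolP (j \in F).
  by rewrite (disjointFr disFG jF) (disjointFr disFG')// roleF.
by do 2!case: ifP.
Qed.

(** Relabelling the Byzantine strategies by [p] is a bijection of [profiles T], so both sets collect
    the same payoffs. Values in [T] are required because [symmetric_game] only relates profiles in
    [T]. *)
Lemma payoffs_vs_byzantine_perm (R : realType) (E : topologicalLmodType R) n
    (T : set E) (tau : E) (u : 'I_n -> {ptws 'I_n -> E} -> R)
    (F G F' G' : {set 'I_n}) (i : 'I_n) (p : 'S_n) (sG sG' : 'I_n -> E) (t : E) :
  T tau -> symmetric_game T u ->
  (forall j, (p j \in F') = (j \in F)) -> (forall j, (p j \in G') = (j \in G)) ->
  (forall j, j \in G -> sG' (p j) = sG j) -> (forall j, j \in G -> T (sG j)) -> T t ->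
  payoffs_vs_byzantine T tau u F' G' sG' (p i) t =
  payoffs_vs_byzantine T tau u F G sG i t.
Proof.
move=> Ttau sym pF pG sGE sGT tT.
have dfE j : j \in G -> dfwith sG' (p i) t (p j) = dfwith sG i t j.
  move=> jG; have [->|ji] := eqVneq j i; first by rewrite !dfwithin.
  have pji : p i != p j by rewrite (inj_eq perm_inj) eq_sym.
  by rewrite dfwithout// dfwithout 1?eq_sym// sGE.
have key sF : profiles T sF ->
    u (p i) (concat tau F' G' sF (dfwith sG' (p i) t)) =
    u i (concat tau F G (fun j => sF (p j)) (dfwith sG i t)).
  move=> sFT; rewrite sym; last first.
    move=> j; rewrite -(permKV p j) /concat pF pG; case: ifP => _; first exact: sFT.
    case: ifP => // jG; rewrite dfE//.
    by case: dfwithP jG => // k _ kG; exact: sGT.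
  congr (u i _); apply/funext => j; rewrite /concat pF pG.
  by case: ifP => // _; case: ifP => // /dfE.
apply/seteqP; split=> _ [sF sFT <-].
  by exists (fun j => sF (p j)) => [j|]; [exact: sFT|rewrite -key].
exists (fun j => sF (p^-1%g j)) => [j|]; first exact: sFT.
rewrite key; last by move=> j; exact: sFT.
by congr (u i (concat _ _ _ _ _)); apply/funext => j; rewrite permK.
Qed.

Theorem theorem1 (R : realType) (E : topologicalLmodType R) (n : nat)
    (T : set E) (tau : E) (u : 'I_n -> {ptws 'I_n -> E} -> R)
    (Ttau : T tau) (convT : convex_set T) (compT : compact T) :
  (forall F G : {set 'I_n}, [disjoint F & G]%B ->
     continuous_payoffs T u G -> concave_payoffs T tau u F G ->
     exists sG : 'I_n -> E, BARNE T tau u F G sG)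
  /\
  (symmetric_game T u ->
   forall (f g : nat) (F G : {set 'I_n}), [disjoint F & G]%B ->
     #|F| = f -> #|G| = g ->
     continuous_payoffs T u G -> concave_payoffs T tau u F G ->
     exists2 sigma : E, T sigma & BARNE_sizes T tau u f (nseq_tuple g sigma)).
Proof.
split=> [F G disFG contu concu|sym f g F G disFG cF cG contu concu].
  exact: (BARNE_existence Ttau convT compT contu disFG concu).
have [G0|[i iG]] := set_0Vmem G.
  (* With [G] empty, [g] is 0 and every [G'] of that size is empty, so the condition is vacuous. *)
  exists tau => // F' G' _ _ cG' i.
  have /cards0_eq-> : #|G'| = 0%N by rewrite cG' -cG G0 cards0.
  by rewrite inE.
have [sigma sigmaT best] :=
  symmetric_best_response Ttau convT compT contu disFG concu iG.
exists sigma => // F' G' disFG' cF' cG' i' iG'.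
have assignE j : j \in G' -> assign G' (nseq_tuple g sigma) j = sigma.
  move=> jG'; rewrite /assign /= nth_nseq; case: ifP => // /negbT.
  by rewrite -cG' cardE index_mem mem_enum jG'.
have [||p [pi pF pG]] := role_perm disFG disFG' iG iG'; [by rewrite cF|by rewrite cG|].
(* By relabelling, [i'] faces at [(F', G')] the payoff sets that [i] faces at [(F, G)], so the worst
   payoffs of [i] serve for both. *)
exists (fun t => worst_payoff T tau u F G i (dfwith (fun=> sigma) i t)).
  move=> t tT.
  rewrite -pi (@payoffs_vs_byzantine_perm _ _ _ T tau u F G _ _ i p (fun=> sigma))//.
    exact: worst_payoff_minima (profiles_dfwith i (fun=> sigmaT) tT).
  by move=> j jG; rewrite assignE// pG.
rewrite assignE//; split=> // t tT.
by rewrite (dfwith_id (fun=> sigma : E) i); exact: best.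
Qed.
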